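(* Suppose that $B \subseteq \mathbb{R}^n$ is nonempty and compact, that $F:\mathbb{R}^n\times\mathbb{R}^n\to\mathbb{R}^n$ is continuous on $\mathbb{R}^n \times \mathbb{R}^n$, and that $F(\cdot,y)$ is Lipschitz continuous on $B$, uniformly with respect to $y$, with constant $L_F$, i.e. $\|F(x,y)-F(x',y)\|\le L_F\|x-x'\|$ for all $x,x'\in B$ and all $y\in\mathbb{R}^n$. Then, for any $\alpha \geq 0$, the gap function $\varphi_\alpha$ is Lipschitz continuous on $B$ with constant $$L_1 + L_2\,L_F + \alpha\,L_2,$$ where $$L_1 = \max_{x \in B,\, y \in \mathcal{C}} \|F(x,y)\|, \qquad L_2 = \max_{x \in B,\, y \in \mathcal{C}} \|x - y\|.$$
   Context: $\mathcal{C}\subseteq\mathbb{R}^n$ is a nonempty compact convex set, $F:\mathbb{R}^n\times\mathbb{R}^n\to\mathbb{R}^n$ is a map, and $f:\mathbb{R}^n\times\mathbb{R}^n\to\mathbb{R}$ is the bifunction $f(x,y)=\langle F(x,y),\,y-x\rangle$. Standing assumptions: $f$ is continuous, and for any $x\in\mathcal{C}$ the function $f(x,\cdot)$ is convex and $f(x,x)=0$. For $\alpha\ge 0$, the gap function is $$\varphi_\alpha(x) := \max_{y \in \mathcal{C}} \left[ -f(x,y) - \frac{\alpha}{2}\,\|y-x\|^2 \right],\qquad x\in\mathbb{R}^n.$$ $\|\cdot\|$ and $\langle\cdot,\cdot\rangle$ denote the Euclidean norm and inner product. ''Lipschitz continuous on $B$ with constant $K$'' means $|\varphi_\alpha(x)-\varphi_\alpha(x')|\le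 K\|x-x'\|$ for all $x,x'\in B$. *)

(* Defs.v *)
From HB Require Import structures.
From mathcomp Require Import all_boot all_order all_algebra.
From mathcomp Require Import all_classical all_reals all_analysis.
Set Implicit Arguments.
Unset Strict Implicit.
Unset Printing Implicit Defensive.
Import Order.TTheory GRing.Theory Num.Theory.
Import numFieldNormedType.Exports.
Local Open Scope classical_set_scope.
Local Open Scope ring_scope.

Section Euclidean.
Context {R : realType} {n : nat}.

Definition inner (u v : 'rV[R]_n) : R := \sum_(i < n) u ord0 i * v ord0 i.

(* The library norm `|u| on row vectors is the sup norm; it induces the same
   topology, but the Lipschitz constants refer to the Euclidean norm. *)
Definition enorm (u : 'rV[R]_n) : R := Num.sqrt (inner u u).

Definition elipschitz_on (B : set 'rV[R]_n) (K : R) (g : 'rV[R]_n -> R) : Prop :=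
  forall x x', B x -> B x' -> `|g x - g x'| <= K * enorm (x - x').

End Euclidean.

(* Greatest element of A; by convention 0 when A has none. *)
Definition maximum {R : realType} (A : set R) : R := xget 0 (A `&` ubound A).

Lemma maximumE {R : realType} (A : set R) (m : R) :
  A m -> ubound A m -> maximum A = m.
Proof.
move=> Am um; apply: xget_subset1 => // a b [Aa ua] [Ab ub].
by apply/eqP; rewrite eq_le ub// ua.
Qed.

Lemma maximum_compact {R : realType} (T : topologicalType) (A : set T)
    (g : T -> R) : A !=set0 -> compact A -> {within A, continuous g} ->
  (g @` A) (maximum (g @` A)) /\ ubound (g @` A) (maximum (g @` A)).
Proof.
move=> A0 cA cg; have [c cinA gc] := compact_EVT_max A0 cA cg.
have Ac : (g @` A) (g c) by exists c => //; exact/set_mem.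
have uc : ubound (g @` A) (g c).
  by move=> _ [t At <-]; apply: gc; exact/mem_set.
by rewrite (maximumE Ac uc).
Qed.

Section Gap.
Context {R : realType} {n : nat}.
Variable F : 'rV[R]_n -> 'rV[R]_n -> 'rV[R]_n.

Definition bifunction (x y : 'rV[R]_n) : R := inner (F x y) (y - x).

Definition gap (C : set 'rV[R]_n) (alpha : R) (x : 'rV[R]_n) : R :=
  maximum [set - bifunction x y - alpha / 2 * enorm (y - x) ^+ 2 | y in C].

End Gap.

(* Main.v *)
(** Write [h x y] for the function of [y] maximised in the gap.  For [x, x']
    in [B] and [y] in [C],
      [h x y - h x' y = <F x y, x - x'> + <F x' y - F x y, y - x'>
                        + alpha / 2 <x - x', (y - x) + (y - x')>],
    and Cauchy-Schwarz bounds the right-hand side by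
    [(L1 + L2 L_F + alpha L2) |x - x'|], uniformly in [y]; maxima of functions
    that differ uniformly by at most [e] differ by at most [e]. *)
Require Import Defs.
From HB Require Import structures.
From mathcomp Require Import all_boot all_order all_algebra.
From mathcomp Require Import ring lra.
From mathcomp Require Import all_classical all_reals all_analysis.
Import Order.TTheory GRing.Theory Num.Theory.
Import numFieldNormedType.Exports.
Local Open Scope classical_set_scope.
Local Open Scope ring_scope.

Section InnerProduct.
Context {R : realType} {n : nat}.
Implicit Types u v w : 'rV[R]_n.

Lemma innerC u v : inner u v = inner v u.
Proof. by apply: eq_bigr => i _; rewrite mulrC. Qed.

Lemma innerDl u v w : inner (u + v) w = inner u w + inner v w.
Proof. by rewrite -big_split; apply: eq_bigr => i _; rewrite mxE mulrDl. Qed.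

Lemma innerZl (a : R) u v : inner (a *: u) v = a * inner u v.
Proof. by rewrite /inner mulr_sumr; apply: eq_bigr => i _; rewrite mxE mulrA. Qed.

Lemma innerNl u v : inner (- u) v = - inner u v.
Proof. by rewrite -scaleN1r innerZl mulN1r. Qed.

Lemma innerDr u v w : inner u (v + w) = inner u v + inner u w.
Proof. by rewrite innerC innerDl !(innerC u). Qed.

Lemma innerZr (a : R) u v : inner u (a *: v) = a * inner u v.
Proof. by rewrite innerC innerZl innerC. Qed.

Lemma innerNr u v : inner u (- v) = - inner u v.
Proof. by rewrite innerC innerNl innerC. Qed.

Lemma inner_ge0 u : 0 <= inner u u.
Proof. by apply: sumr_ge0 => i _; rewrite -expr2 sqr_ge0. Qed.

Lemma enorm_ge0 u : 0 <= enorm u.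
Proof. exact: sqrtr_ge0. Qed.

Lemma enorm_sqr u : enorm u ^+ 2 = inner u u.
Proof. by rewrite sqr_sqrtr// inner_ge0. Qed.

Lemma enormN u : enorm (- u) = enorm u.
Proof. by rewrite /enorm innerNl innerNr opprK. Qed.

Lemma enormB u v : enorm (u - v) = enorm (v - u).
Proof. by rewrite -enormN opprB. Qed.

Lemma enorm0_eq0 u : enorm u = 0 -> u = 0.
Proof.
move=> u0; have /eqP : inner u u = 0 by rewrite -enorm_sqr u0 expr0n.
rewrite psumr_eq0 => [/allP u0i|i _]; last by rewrite -expr2 sqr_ge0.
apply/rowP => i; rewrite mxE; apply/eqP.
by have := u0i i (mem_index_enum i); rewrite mulf_eq0 orbb.
Qed.

(* Expand [0 <= |(|v| u - |u| v)|^2 = 2 |u| |v| (|u| |v| - <u, v>)]. *)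
Lemma inner_le_enorm u v : inner u v <= enorm u * enorm v.
Proof.
(* The final step cancels [enorm u * enorm v], so zero norms are treated first: they force a zero
   vector, and both sides vanish. *)
have [u0|u0] := eqVneq (enorm u) 0.
  by rewrite u0 (enorm0_eq0 _ u0) -(scale0r 0) innerZl !mul0r.
have [v0|v0] := eqVneq (enorm v) 0.
  by rewrite v0 (enorm0_eq0 _ v0) -(scale0r 0) innerZr mulr0 mul0r.
have uv_gt0 : 0 < enorm u * enorm v.
  by rewrite mulr_gt0// lt_neqAle eq_sym ?u0 ?v0 enorm_ge0.
have := inner_ge0 (enorm v *: u - enorm u *: v).
rewrite innerDl !innerDr !(innerNl, innerNr, innerZl, innerZr).
rewrite -!enorm_sqr (innerC v u) => h; rewrite -(ler_pM2l uv_gt0).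
by move: h; set a := enorm u; set b := enorm v; set c := inner u v; nra.
Qed.

Lemma continuous_inner (T : topologicalType) (f g : T -> 'rV[R]_n) :
  continuous f -> continuous g -> continuous (fun t => inner (f t) (g t)).
Proof.
move=> cf cg t; apply: cvg_big => [|i _].
  by move=> a; exact: add_continuous.
apply: cvgM.
- exact: (continuous_comp (cf t) (@coord_continuous _ _ _ ord0 i _)).
- exact: (continuous_comp (cg t) (@coord_continuous _ _ _ ord0 i _)).
Qed.

Lemma continuous_enorm (T : topologicalType) (f : T -> 'rV[R]_n) :
  continuous f -> continuous (fun t => enorm (f t)).
Proof.
move=> cf t; apply: (@continuous_comp _ _ _
  (fun t => inner (f t) (f t)) Num.sqrt).
  exact: continuous_inner.
exact: sqrt_continuous.
Qed.

Lemma continuous_enormB (T : topologicalType) (f g : T -> 'rV[R]_n) :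
  continuous f -> continuous g -> continuous (fun t => enorm (f t - g t)).
Proof.
move=> cf cg; apply: continuous_enorm => t.
exact: (@continuousB R 'rV[R]_n T f g t (cf t) (cg t)).
Qed.

End InnerProduct.

(** Serves to bound by [L1] and [L2]. Since [maximum] defaults to 0, one must know that the maximum
    is attained; this follows from the extreme value theorem on the compact product [A * D]. *)
Lemma maximum_image2_ge {R : realType} (T U : topologicalType) (A : set T)
    (D : set U) (g : T -> U -> R) (a : T) (d : U) :
  compact A -> compact D -> continuous (fun p : T * U => g p.1 p.2) ->
  A a -> D d -> g a d <= maximum [set g x y | x in A & y in D].
Proof.
move=> cA cD cg Aa Dd.
have -> : [set g x y | x in A & y in D]
        = (fun p => g p.1 p.2) @` (A `*` D).
  apply/seteqP; split => [_ [x Ax [y Dy <-]]|_ [[x y] [Ax Dy] <-]].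
    by exists (x, y).
  by exists x => //; exists y.
have [_] := maximum_compact (ex_intro _ (a, d) (conj Aa Dd) : A `*` D !=set0)
  (compact_setX cA cD) (continuous_subspaceT cg).
by apply; exists (a, d).
Qed.

(** Evaluate at a maximiser [t] of [g]: [max g = g t <= h t + e <= max h + e]. Compactness and
    continuity rule out the default value of [maximum] on both sides. *)
Lemma maximum_image_le {R : realType} (T : topologicalType) (A : set T)
    (g h : T -> R) (e : R) : A !=set0 -> compact A ->
  continuous g -> continuous h -> (forall t, A t -> g t <= h t + e) ->
  maximum (g @` A) <= maximum (h @` A) + e.
Proof.
move=> A0 cA cg ch gh.
have [[t At <-] _] := maximum_compact A0 cA (continuous_subspaceT cg).
have [_ hle] := maximum_compact A0 cA (continuous_subspaceT ch).
by apply: (le_trans (gh t At)); rewrite lerD2r; apply: hle; exists t.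
Qed.

Section GapObjective.
Context {R : realType} {n : nat}.
Variables (F : 'rV[R]_n -> 'rV[R]_n -> 'rV[R]_n) (alpha : R).

Definition gap_objective (x y : 'rV[R]_n) : R :=
  - bifunction F x y - alpha / 2 * enorm (y - x) ^+ 2.

Lemma continuous_gap_objective (x : 'rV[R]_n) :
  continuous (fun p : 'rV[R]_n * 'rV[R]_n => bifunction F p.1 p.2) ->
  continuous (gap_objective x).
Proof.
move=> cf y.
have cfx : bifunction F x z @[z --> y] --> bifunction F x y.
  apply: (@continuous_comp _ _ _ (fun z => (x, z))
    (fun p : 'rV[R]_n * 'rV[R]_n => bifunction F p.1 p.2)); last exact: cf.
  apply: (@cvg_pair _ _ _ (nbhs y) (nbhs x) (nbhs y));
    [exact: cvg_cst|exact: cvg_id].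
have cn : continuous (fun z : 'rV[R]_n => enorm (z - x)).
  apply: continuous_enormB; [by move=> z; exact: cvg_id|exact: cst_continuous].
exact: (cvgB (cvgN cfx) (cvgM (cvg_cst _) (cvgM (cn y) (cn y)))).
Qed.

(** The bifunction terms are split by writing [y - x = (y - x') - (x - x')] against [F x y]. The
    quadratic terms are a difference of squares whose factors are [x - x'] and
    [(y - x) + (y - x')]. *)
Lemma gap_objective_sub (x x' y : 'rV[R]_n) :
  gap_objective x y - gap_objective x' y =
  inner (F x y) (x - x') + inner (F x' y - F x y) (y - x')
  + alpha / 2 * (inner (x - x') (y - x) + inner (x - x') (y - x')).
Proof.
rewrite /gap_objective /bifunction !enorm_sqr.
rewrite !(innerDl, innerDr, innerNl, innerNr).
(* Mirrored inner products are distinct atoms for [ring], so each pair gets one orientation. *)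
rewrite (innerC x' x) (innerC y x) (innerC y x').
by ring.
Qed.

End GapObjective.

Theorem theorem3p1 (R : realType) (n : nat)
  (C : set 'rV[R]_n) (F : 'rV[R]_n -> 'rV[R]_n -> 'rV[R]_n)
  (C_nonempty : C !=set0) (C_compact : compact C) (C_convex : convex_set C)
  (f_continuous :
    continuous (fun p : 'rV[R]_n * 'rV[R]_n => bifunction F p.1 p.2))
  (f_convex : forall x, C x -> convex_function setT (bifunction F x))
  (f_diag : forall x, C x -> bifunction F x x = 0)
  (B : set 'rV[R]_n) (B_nonempty : B !=set0) (B_compact : compact B)
  (F_continuous : continuous (fun p : 'rV[R]_n * 'rV[R]_n => F p.1 p.2))
  (L_F : R)
  (F_lipschitz : forall x x' y, B x -> B x' ->
    enorm (F x y - F x' y) <= L_F * enorm (x - x'))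
  (alpha : R) (alpha_ge0 : 0 <= alpha) :
  let L1 := maximum [set enorm (F x y) | x in B & y in C] in
  let L2 := maximum [set enorm (x - y) | x in B & y in C] in
  elipschitz_on B (L1 + L2 * L_F + alpha * L2) (gap F C alpha).
Proof.
move=> L1 L2.
have L1_ge x y : B x -> C y -> enorm (F x y) <= L1.
  apply: maximum_image2_ge => //.
  exact: continuous_enorm.
have L2_ge x y : B x -> C y -> enorm (x - y) <= L2.
  apply: (maximum_image2_ge _ _ B C
    (fun x y : 'rV[R]_n => enorm (x - y)) x y) => //.
  by apply: continuous_enormB => p; [exact: cvg_fst|exact: cvg_snd].
have one_sided x x' : B x -> B x' -> gap F C alpha x <=
    gap F C alpha x' + (L1 + L2 * L_F + alpha * L2) * enorm (x - x').
  move=> Bx Bx'.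
  (* By conversion, [gap F C alpha x] is the [maximum] of the image of [C] under
     [gap_objective F alpha x]. *)
  apply: maximum_image_le => //; try exact: continuous_gap_objective.
  move=> y Cy; rewrite -lerBlDl gap_objective_sub.
  have d_ge0 := enorm_ge0 (x - x').
  have b1 : inner (F x y) (x - x') <= L1 * enorm (x - x').
    by apply: (le_trans (inner_le_enorm _ _)); rewrite ler_wpM2r// L1_ge.
  have b2 : inner (F x' y - F x y) (y - x') <= L_F * enorm (x - x') * L2.
    apply: (le_trans (inner_le_enorm _ _)).
    rewrite enormB (enormB y).
    by apply: ler_pM; rewrite ?enorm_ge0 ?F_lipschitz ?L2_ge.
  have b3 z : B z -> inner (x - x') (y - z) <= enorm (x - x') * L2.
    move=> Bz; apply: (le_trans (inner_le_enorm _ _)).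
    by rewrite ler_wpM2l// enormB L2_ge.
  (* Using [b3] at both [x] and [x'] gives twice [enorm (x - x') * L2]; the factor [alpha / 2] turns
     this into the term [alpha * L2] of the constant. *)
  have := ler_wpM2l (divr_ge0 alpha_ge0 (ler0n R 2)) (lerD (b3 x Bx) (b3 x' Bx')).
  by move: b1 b2; lra.
(* The error term is symmetric in [x] and [x'], so swapping them in [one_sided] gives the lower
   bound. *)
move=> x x' Bx Bx'; rewrite ler_norml; apply/andP; split.
  by rewrite lerNl opprB lerBlDl enormB one_sided.
by rewrite lerBlDl one_sided.
Qed.
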